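(* Let $\mathcal{H}$ be a complex Hilbert space, let $A\in\mathcal{B}(\mathcal{H})$ be a quasinormal operator and $B\in\mathcal{B}(\mathcal{H})$ a normal operator such that $AB=\lambda BA\neq 0$, where $\lambda\in\mathbb{C}$. If $|\lambda|=1$, then $AB$ is a quasinormal operator.
   Context: $\mathcal{B}(\mathcal{H})$ denotes the algebra of all bounded linear operators on the complex Hilbert space $\mathcal{H}$. An operator $T\in\mathcal{B}(\mathcal{H})$ is normal if $T^*T=TT^*$, and quasinormal if $T(T^*T)=(T^*T)T$. *)

(* Defs.v *)
From HB Require Import structures.
From mathcomp Require Import all_boot all_order all_algebra.
From mathcomp Require Import complex.
From mathcomp Require Import all_classical all_reals all_analysis.
From mathcomp Require Import ring lra.

Set Implicit Arguments.
Unset Strict Implicit.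
Unset Printing Implicit Defensive.
Import Order.TTheory GRing.Theory Num.Theory.
Import numFieldNormedType.Exports.
Local Open Scope classical_set_scope.
Local Open Scope ring_scope.
Local Open Scope complex_scope.

(* The inner product is linear in its first argument and conjugate-linear in
   its second one, as in MathComp's {dot _ for _}.  Completeness comes from
   completeNormedModType, whose norm is required to be the one induced by the
   inner product. *)
HB.mixin Record isHilbert (R : realType) H & CompleteNormedModule R[i] H := {
  inner : {dot H for (@Num.conj R[i])} ;
  sqr_normE : forall x : H, `|x| ^+ 2 = inner x x
}.

#[short(type="hilbertType")]
HB.structure Definition Hilbert (R : realType) :=
  {H of CompleteNormedModule R[i] H & isHilbert R H}.

HB.mixin Record isBoundedOp (R : realType) (H : hilbertType R) (f : H -> H) := {
  op_bounded : exists M : R, forall x : H, `|f x| <= M%:C * `|x|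
}.

#[short(type="boundedOp")]
HB.structure Definition BoundedOp (R : realType) (H : hilbertType R) :=
  {f of @GRing.Linear R[i] H H *:%R f & isBoundedOp R H f}.

Section Comp.
Variables (R : realType) (H : hilbertType R) (f g : boundedOp H).

Let comp_bounded : exists M : R, forall x : H, `|(f \o g) x| <= M%:C * `|x|.
Proof.
have [[M fM] [P gP]] := (@op_bounded _ _ f, @op_bounded _ _ g).
exists (`|M| * P) => x /=; apply: le_trans (fM _) _.
have MM : M%:C <= `|M|%:C by rewrite lecR ler_norm.
apply: le_trans (ler_wpM2r (normr_ge0 _) MM) _.
rewrite rmorphM /= -mulrA; apply: ler_wpM2l; last exact: gP.
by rewrite lecR.
Qed.

HB.instance Definition _ := isBoundedOp.Build R H (f \o g) comp_bounded.

End Comp.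

Section Riesz.
Variables (R : realType) (H : hilbertType R).
Implicit Types x y z : H.

Let N x : R := complex.Re `|x|.
Let ri x y : R := complex.Re (inner x y).

Let normE x : `|x| = (N x)%:C.
Proof.
by rewrite /N RRe_real ?normr_real.
Qed.

Let N_ge0 x : 0 <= N x.
Proof. by rewrite -lecR -normE; exact: normr_ge0. Qed.

Let ReD (a b : R[i]) : complex.Re (a + b) = complex.Re a + complex.Re b.
Proof. by case: a; case: b. Qed.

Let ReM (t : R) (b : R[i]) : complex.Re (t%:C * b) = t * complex.Re b.
Proof. by case: b => c d /=; rewrite mul0r subr0. Qed.

Let riDl x y z : ri (x + y) z = ri x z + ri y z.
Proof. by rewrite /ri linearDl ReD. Qed.

Let riZl (t : R) x z : ri (t%:C *: x) z = t * ri x z.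
Proof. by rewrite /ri linearZl_LR ReM. Qed.

Lemma innerC x y : inner x y = Num.conj (inner y x).
Proof. by rewrite (hermC (inner : {dot H for _})) expr0 mul1r. Qed.

Let riC x y : ri x y = ri y x.
Proof. by rewrite /ri innerC; case: (inner y x). Qed.

Let riDr x y z : ri z (x + y) = ri z x + ri z y.
Proof. by rewrite riC riDl !(riC z). Qed.

Let riZr (t : R) x z : ri z (t%:C *: x) = t * ri z x.
Proof. by rewrite riC riZl (riC z). Qed.

Let rixx x : ri x x = N x ^+ 2.
Proof. by rewrite /ri -sqr_normE normE -rmorphXn. Qed.

Let N_triangle x y : N (x + y) <= N x + N y.
Proof. by rewrite -lecR rmorphD /= -!normE ler_normD. Qed.

Let NN x : N (- x) = N x.
Proof. by rewrite /N normrN. Qed.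

Let ri_le x y : ri x y <= N x * N y.
Proof.
have := N_triangle x y; have := N_ge0 (x + y); move: (rixx (x + y)).
rewrite riDl !riDr (riC y x) !rixx => + h0 h1.
have : N (x + y) ^+ 2 <= (N x + N y) ^+ 2 by rewrite lerXn2r ?nnegrE ?addr_ge0.
by move=> h2 h3; rewrite -h3 in h2; nra.
Qed.

Let riesz (phi : H -> R[i]) (M : R) :
  (forall (a : R[i]) x y, phi (a *: x + y) = a * phi x + phi y) ->
  (forall x, complex.Re (phi x) <= M * N x) ->
  exists w : H, forall x, phi x = inner x w.
Proof.
move=> phil phiM; pose p x := complex.Re (phi x).
have phiD x y : phi (x + y) = phi x + phi y.
  by have := phil 1 x y; rewrite scale1r mul1r.
have phi0 : phi 0 = 0 by apply: (addrI (phi 0)); rewrite -phiD !addr0.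
have phiZ a x : phi (a *: x) = a * phi x.
  by have := phil a x 0; rewrite phi0 !addr0.
have pD x y : p (x + y) = p x + p y by rewrite /p phiD ReD.
have pZ (t : R) x : p (t%:C *: x) = t * p x by rewrite /p phiZ ReM.
pose J x := ri x x - 2 * p x.
have JD x y : J (x + y) = J x + N y ^+ 2 + 2 * (ri x y - p y).
  by rewrite /J riDl !riDr pD (riC y x) !rixx; ring.
pose m := inf (range J).
have infJ : has_inf (range J).
  split; first by exists (J 0), 0.
  exists (- M ^+ 2) => _ [x _ <-]; rewrite /J rixx.
  have := phiM x; have := sqr_ge0 (N x - M); rewrite /p; nra.
have mle x : m <= J x by apply: ge_inf; [exact: infJ.2|exists x].
pose S (d : R) : set H := [set x | J x < m + d].
have S0 d : 0 < d -> S d !=set0.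
  by move=> d0; have [_ [x _ <-] ?] := inf_adherent d0 infJ; exists x.
pose F := filter_from [set d : R | 0 < d] S.
have FF : ProperFilter F.
  apply: filter_from_proper => //; apply: filter_from_filter; first by exists 1 => /=.
  move=> d e /= d0 e0; exists (Num.min d e); first by rewrite /= lt_min d0.
  move=> x; rewrite /S /= => xde.
  have h1 : Num.min d e <= d by rewrite ge_min lexx.
  have h2 : Num.min d e <= e by rewrite ge_min lexx orbT.
  by split; lra.
have SN d x y : S d x -> S d y -> N (x - y) ^+ 2 <= 4 * d.
  rewrite /S /= => xd yd.
  have := mle ((2^-1)%:C *: (x + y)).
  have -> : N (x - y) ^+ 2 = 2 * ri x x + 2 * ri y y - ri (x + y) (x + y).
    rewrite -rixx !riDl !riDr.
    have -> : - y = (-1)%:C *: y by rewrite rmorphN1 scaleN1r.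
    by rewrite !riZr !riZl (riC y x); ring.
  rewrite /J riZl riZr pZ pD in xd yd *.
  have : (2^-1 : R) * (2^-1) = 4^-1 by rewrite -invfM -natrM.
  have : (2^-1 : R) * 2 = 1 by rewrite mulVf.
  by move=> *; lra.
have Fc : cauchy F.
  apply: cauchy_exP => e e0.
  have [r r0 ->] : exists2 r : R, 0 < r & e = r%:C.
    move: e0; case: e => a b; rewrite ltcE /= => /andP[/eqP -> a0].
    by exists a.
  pose d := r ^+ 2 / 8.
  have d0 : 0 < d by rewrite divr_gt0 ?exprn_gt0.
  have [x xd] := S0 _ d0.
  exists x, d => // y yd.
  rewrite -ball_normE /ball_ /= normE ltcR.
  have := SN _ _ _ xd yd; have := N_ge0 (x - y); rewrite /d => h0 h.
  have r2 : 0 < r ^+ 2 by rewrite exprn_gt0.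
  by rewrite -(@ltr_pXn2r _ 2) ?nnegrE ?(ltW r0)//; lra.
have /cvg_ex[w Fw] : cvg F by exact/cauchy_cvgP.
have Jw : J w <= m.
  apply/ler_addgt0Pr => d d0.
  pose C := 2 * (N w + `|M|) + 1.
  have C0 : 0 < C by have := N_ge0 w; have := normr_ge0 M; rewrite /C; lra.
  pose e := d / 2 / C.
  have e0 : 0 < e by rewrite !divr_gt0.
  have : F (S (d / 2) `&` ball w e%:C).
    apply: filterI; first by exists (d / 2) => //=; rewrite divr_gt0.
    by apply: Fw; apply: nbhsx_ballx; rewrite ltcR.
  move=> /filter_ex[x [xd]]; rewrite -ball_normE /ball_ /= normE ltcR => we.
  have := JD w (x - w); rewrite [w + _]addrC subrK.
  have -> : N (x - w) = N (w - x) by rewrite -NN opprB.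
  have := ri_le w (w - x); have := phiM (x - w); rewrite -/(p _).
  have -> : N (x - w) = N (w - x) by rewrite -NN opprB.
  have -> : ri w (w - x) = - ri w (x - w).
    have -> : w - x = (-1)%:C *: (x - w) by rewrite rmorphN1 scaleN1r opprB.
    by rewrite riZr mulN1r.
  move: xd; rewrite /S /= => xd h1 h2 h3.
  have n0 := N_ge0 (w - x).
  have h4 : M * N (w - x) <= `|M| * N (w - x) by rewrite ler_wpM2r ?ler_norm.
  have h5 : C * N (w - x) <= d / 2.
    by rewrite -ler_pdivlMl// mulrC ltW.
  have := sqr_ge0 (N (w - x)); move: h5; rewrite /C => h5.
  by lra.
have crit z : ri w z = p z.
  set q := N z ^+ 2; have q0 : 0 <= q by rewrite sqr_ge0.
  have key (t : R) : 0 <= t ^+ 2 * q + 2 * t * (ri w z - p z).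
    have := JD w (t%:C *: z); have := mle (w + t%:C *: z).
    by rewrite -rixx riZl riZr riZr pZ rixx -/q => h1 h2; lra.
  set a := ri w z - p z in key.
  have q1 : q + 1 != 0 by rewrite gt_eqF// ltr_wpDl.
  have := key (- a / (q + 1)).
  have -> : (- a / (q + 1)) ^+ 2 * q + 2 * (- a / (q + 1)) * a =
     - (a ^+ 2 * ((q + 2) / (q + 1) ^+ 2)) by field.
  rewrite oppr_ge0 pmulr_lle0; last first.
    by rewrite divr_gt0 ?exprn_gt0// ltr_wpDl.
  by move=> h; apply/eqP; rewrite -subr_eq0 -sqrf_eq0 eq_le h sqr_ge0.
exists w => x; apply/eqP; rewrite eq_complex; apply/andP; split; apply/eqP.
  by rewrite -[LHS]/(p x) -crit riC.
have := crit ('i%C *: x); rewrite riC /ri /p phiZ linearZl_LR.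
by rewrite /= [_ * inner _ _]mulrC [_ * phi _]mulrC !ReiNIm => /oppr_inj ->.
Qed.

Lemma innerPr (a : R[i]) x u v :
  inner x (a *: u + v) = Num.conj a * inner x u + inner x v.
Proof. exact: linearP. Qed.

Lemma inner_inj (u v : H) : (forall x, inner x u = inner x v) -> u = v.
Proof.
move=> uv; apply/eqP; rewrite -subr_eq0 -normr_eq0 -sqrf_eq0 sqr_normE.
by rewrite linearBr subr_eq0; apply/eqP; exact: uv.
Qed.

Let adj_ex (T : boundedOp H) y :
  exists w : H, forall x, inner (T x) y = inner x w.
Proof.
have [M TM] := @op_bounded _ _ T.
apply: (@riesz (fun x => inner (T x) y) (M * N y)) => [a u v|x].
  by rewrite linearP linearPl.
apply: le_trans (ri_le _ _) _; rewrite mulrAC ler_wpM2r//.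
by rewrite -lecR rmorphM /= -!normE.
Qed.

Definition adj (T : boundedOp H) (y : H) : H := projT1 (cid (adj_ex T y)).

Lemma adjP (T : boundedOp H) x y : inner (T x) y = inner x (adj T y).
Proof. exact: (projT2 (cid (adj_ex T y))). Qed.

Lemma adj_unique (T : boundedOp H) (S : H -> H) :
  (forall x y, inner (T x) y = inner x (S y)) -> S = adj T.
Proof.
by move=> TS; apply/funext => y; apply: inner_inj => x; rewrite -TS adjP.
Qed.

Let adj_linear (T : boundedOp H) : linear (adj T).
Proof.
move=> a u v; apply: inner_inj => x.
by rewrite -adjP !innerPr -!adjP.
Qed.

HB.instance Definition _ (T : boundedOp H) :=
  GRing.isLinear.Build R[i] H H *:%R (adj T) (@adj_linear T).

Let adj_bounded (T : boundedOp H) :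
  exists M : R, forall y : H, `|adj T y| <= M%:C * `|y|.
Proof.
have [M TM] := @op_bounded _ _ T.
exists M => y; rewrite !normE -rmorphM /= lecR.
have := ri_le (T (adj T y)) y; rewrite /ri adjP -/(ri _ _) rixx => h1.
have : N (T (adj T y)) <= M * N (adj T y).
  by rewrite -lecR rmorphM /= -!normE.
have := N_ge0 y; have := N_ge0 (adj T y); rewrite le_eqVlt => /predU1P[A0|A0] y0 h2.
  rewrite -A0 mulr0 in h2 *.
  have [M0|M0] := leP 0 M; first by rewrite mulr_ge0.
  have /= := TM y; rewrite !normE -rmorphM /= lecR => h3.
  by have := N_ge0 (T y); nra.
rewrite -(ler_pM2l A0) -expr2; apply: le_trans h1 _; nra.
Qed.

HB.instance Definition _ (T : boundedOp H) :=
  isBoundedOp.Build R H (adj T) (adj_bounded T).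

End Riesz.

Definition normal_op (R : realType) (H : hilbertType R) (T : boundedOp H) :=
  adj T \o T = T \o adj T.

Definition quasinormal_op (R : realType) (H : hilbertType R)
    (T : boundedOp H) :=
  T \o (adj T \o T) = (adj T \o T) \o T.

(* Main.v *)
Require Import Defs.
From HB Require Import structures.
From mathcomp Require Import all_boot all_order all_algebra.
From mathcomp Require Import complex.
From mathcomp Require Import all_classical all_reals all_analysis.
From mathcomp Require Import ring lra.

Set Implicit Arguments.
Unset Strict Implicit.
Unset Printing Implicit Defensive.
Import Order.TTheory GRing.Theory Num.Theory.
Import numFieldNormedType.Exports.
Local Open Scope classical_set_scope.
Local Open Scope ring_scope.
Local Open Scope complex_scope.

(* Fuglede-Putnam applied to [A B = (lambda B) A], where [B] and [lambda B] are
   normal, gives the same relation for the adjoint of [B].  Since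
   [|lambda| = 1], all phases then cancel: [B] and its adjoint commute with
   [P = adj A A], and [A] commutes with [adj B B]; quasinormality of [A B]
   reduces to that of [A].

   Fuglede-Putnam is proved by Rosenblum's argument with the exponentials
   replaced by Euler products: if [A M = N A], the operator polynomial
   [(1 + z/n adj N)^n A (1 - z/n adj M)^n] has [adj N A - A adj M] as its
   coefficient of [z], and for [n] large it is bounded by [4 |A|] on the circle
   [|z| = r].  Cauchy's estimate with [r] going to infinity concludes. *)

(** * Real-valued norm on complex normed spaces *)

(** Norms over [R[i]] take values in [R[i]]; their real parts are open to [lra] and [nra]. *)
Definition rnorm (R : realType) (V : normedModType R[i]) (x : V) : R :=
  complex.Re `|x|.

Section RealNorm.
Variables (R : realType) (V : normedModType R[i]).
Implicit Types x y : V.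

Lemma rnormE x : `|x| = (rnorm x)%:C.
Proof. by rewrite /rnorm RRe_real ?normr_real. Qed.

Lemma rnorm_ge0 x : 0 <= rnorm x.
Proof. by rewrite -lecR -rnormE; exact: normr_ge0. Qed.

Lemma ler_rnormD x y : rnorm (x + y) <= rnorm x + rnorm y.
Proof. by rewrite -lecR rmorphD /= -!rnormE ler_normD. Qed.

Lemma rnormN x : rnorm (- x) = rnorm x.
Proof. by rewrite /rnorm normrN. Qed.

Lemma rnormZ (z : R[i]) x : rnorm (z *: x) = rnorm (z : R[i]^o) * rnorm x.
Proof. by rewrite {1}/rnorm normrZ !rnormE -rmorphM. Qed.

Lemma rnorm_eq0 x : rnorm x = 0 -> x = 0.
Proof. by move=> x0; apply/eqP; rewrite -normr_eq0 rnormE x0. Qed.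

Lemma ler_rnorm_sum n (F : 'I_n -> V) :
  rnorm (\sum_(i < n) F i) <= \sum_(i < n) rnorm (F i).
Proof.
rewrite -lecR -rnormE rmorph_sum /=; apply: le_trans (ler_norm_sum _ _ _) _.
by apply: ler_sum => i _; rewrite rnormE.
Qed.

Lemma ler_rnorm_iter (f : V -> V) (c : R) n x : 0 <= c ->
  (forall y, rnorm (f y) <= c * rnorm y) -> rnorm (iter n f x) <= c ^+ n * rnorm x.
Proof.
move=> c0 fc; elim: n => [|n IH] /=; first by rewrite mul1r.
by apply: le_trans (fc _) _; rewrite exprS -mulrA ler_wpM2l.
Qed.

End RealNorm.

(** * Roots of unity and Cauchy's estimate *)

(** The order divides [2 ^ k.+1]; were it smaller, it would divide [2 ^ k], but the [2 ^ k]-th power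
    is [-1]. *)
Lemma primitive_root_exp2 (C : numClosedFieldType) k :
  (2 ^ k.+1).-primitive_root ((2 ^ k).-root (-1) : C).
Proof.
set w := _.-root _.
have wk : w ^+ (2 ^ k) = -1 by rewrite rootCK ?expn_gt0.
have w1 : w ^+ (2 ^ k.+1) = 1 by rewrite expnSr exprM wk sqrrN expr1n.
have [m mw] := prim_order_exists (expn_gt0 2 k.+1) w1.
move=> /(dvdn_pfactor _ _ (isT : prime 2))[e]; rewrite leq_eqVlt => /predU1P[->|ek] mE.
  by rewrite -mE.
have : (m %| 2 ^ k)%N by rewrite mE dvdn_exp2l.
by rewrite (prim_order_dvd mw) wk eqNr oner_eq0.
Qed.

(* Cauchy's estimate, the contour integral being an average over roots of
   unity of large order. *)
Lemma cauchy_estimate1 (R : realType) (V : normedModType R[i]) (d : nat)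
    (v : nat -> V) (r M : R) : (1 < d)%N -> 0 < r ->
  (forall z : R[i], rnorm (z : R[i]^o) = r ->
     rnorm (\sum_(j < d) z ^+ j *: v j) <= M) ->
  r * rnorm (v 1%N) <= M.
Proof.
(* As [d < m], the only [j < d] congruent to 1 modulo [m] is 1. *)
move=> d1 r0 fM; set m := (2 ^ d.+1)%N.
have dm : (d <= m)%N by rewrite ltnW// (ltn_trans (ltnSn d))// ltn_expl.
have m0 : (0 < m)%N by rewrite expn_gt0.
have /= := primitive_root_exp2 R[i] d; set w := _.-root _; rewrite -/m => wm.
have w1 : `|w| = 1.
  have := congr1 Num.norm (prim_expr_order wm); rewrite normrX normr1.
  by move/eqP; rewrite pexpr_eq1 ?normr_ge0// => /eqP.
(* [w ^+ (m.-1 * k)] is the inverse of [w ^+ k]: these weights isolate the coefficient of index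
   1. *)
have sumw (j : 'I_d) :
    \sum_(k < m) w ^+ (m.-1 * k) * (w ^+ k) ^+ j = m%:R *+ (j == 1 :> nat).
  have -> : \sum_(k < m) w ^+ (m.-1 * k) * (w ^+ k) ^+ j =
      \sum_(k < m) (w ^+ (m.-1 + j)) ^+ k.
    by apply: eq_bigr => k _; rewrite -!exprM -exprD mulnDl [(j * k)%N]mulnC.
  have [->|j1] := eqVneq (j : nat) 1%N.
    rewrite addn1 prednK// (prim_expr_order wm).
    under eq_bigr do rewrite expr1n.
    by rewrite sumr_const card_ord.
  have : (w ^+ (m.-1 + j) - 1) * \sum_(k < m) (w ^+ (m.-1 + j)) ^+ k = 0.
    by rewrite -subrX1 exprAC (prim_expr_order wm) expr1n subrr.
  move/eqP; rewrite mulf_eq0 => /orP[|/eqP ->//].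
  rewrite subr_eq0 -(prim_order_dvd wm).
  case: (j : nat) (ltn_ord j) j1 => [|[//|i]] jd _.
    by rewrite addn0 gtnNdvd// -ltnS prednK// (leq_trans d1).
  rewrite addnS -addSn prednK// dvdn_addr// => /dvdn_leq => /(_ isT).
  by rewrite leqNgt (leq_trans _ dm)// ltnW.
have key : \sum_(k < m) w ^+ (m.-1 * k) *: (\sum_(j < d) (r%:C * w ^+ k) ^+ j *: v j)
    = (m%:R * r%:C) *: v 1%N.
  transitivity (\sum_(j < d) (r%:C ^+ j * (m%:R *+ (j == 1 :> nat))) *: v j).
    under eq_bigr do rewrite scaler_sumr.
    rewrite exchange_big /=; apply: eq_bigr => j _.
    rewrite -sumw mulr_sumr scaler_suml; apply: eq_bigr => k _.
    by rewrite scalerA exprMn mulrCA.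
  rewrite (bigD1 (Ordinal d1)) //= big1 ?addr0 ?expr1 ?mulr1n ?[_%:C * _]mulrC// => j j1.
  suff /negbTE -> : (j != 1 :> nat) by rewrite mulr0n mulr0 scale0r.
  by [].
have rw k : rnorm ((r%:C * w ^+ k) : R[i]^o) = r.
  by rewrite /rnorm normrM normrX w1 expr1n mulr1 ger0_norm ?ler0c ?ltW.
have : rnorm ((m%:R * r%:C) *: v 1%N) <= \sum_(k < m) M.
  rewrite -key; apply: le_trans (ler_rnorm_sum _) _; apply: ler_sum => k _.
  by rewrite rnormZ {1}/rnorm normrX w1 expr1n /= mul1r fM.
have -> : m%:R * r%:C = (m%:R * r)%:C by rewrite rmorphM rmorph_nat.
rewrite rnormZ {1}/rnorm ger0_norm ?ler0c ?mulr_ge0 ?ler0n ?(ltW r0)//=.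
rewrite sumr_const card_ord -[M *+ m]mulr_natl -mulrA.
by rewrite ler_pM2l ?ltr0n.
Qed.

(** * Numerical bounds on Euler products *)

(** For [C >= 0] this is the factor of [rnorm_conjugated_le] at [d = C / n]. It tends to 1 as [n]
    grows, hence a bound independent of [C]. *)
Lemma exp_factors_le4 (R : realType) (C : R) : exists2 n : nat, (0 < n)%N &
  (1 + 3 * (C / n%:R) ^+ 2) ^+ n * (1 + 3 * (C / n%:R) ^+ 2) ^+ n
  + (1 + `|C| / n%:R) ^+ n * (1 + `|C| / n%:R) ^+ n
    * ((1 + (C / n%:R) ^+ 2) ^+ n - 1) <= 4.
Proof.
have exp_le (t : R) n : 0 <= t -> (1 + t) ^+ n <= expR (n%:R * t).
  move=> t0; rewrite expRM_natl lerXn2r ?nnegrE ?expR_ge0 ?expR_ge1Dx//.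
  by rewrite addr_ge0.
have exp_lin (s : R) : 0 <= s -> s <= 1 / 2 -> expR s <= 1 + 2 * s.
  move=> s0 s2; have := expR_ge1Dx (- s); rewrite expRN => h.
  have e0 := expR_gt0 s.
  have : (1 - s) * expR s <= 1 by rewrite -ler_pdivlMr// mul1r.
  by nra.
pose K := expR `|C| * expR `|C|.
have K0 : 0 <= K by rewrite mulr_ge0 ?expR_ge0.
have KE : expR `|C| * expR `|C| <= K by [].
move: K K0 KE => K K0 KE.
(* [n > x] forces [12 s <= 1] and [2 K s <= 1] for [s = C^2 / n], whence
   [(1 + 6 s)^2 + 2 K s <= 4]. *)
pose x := 12 * C ^+ 2 + 2 * K * C ^+ 2 + 1.
have C2 := sqr_ge0 C.
have KC : 0 <= K * C ^+ 2 by rewrite mulr_ge0.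
have x0 : 0 <= x by rewrite /x; lra.
exists (Num.bound x).
  by rewrite -(ltr0n R); apply: le_lt_trans (archi_boundP x0).
have := archi_boundP x0; set n := Num.bound x => xn.
have n0 : 0 < n%:R :> R by apply: le_lt_trans xn.
pose s := C ^+ 2 / n%:R.
have s0 : 0 <= s by rewrite divr_ge0// ltW.
have ns : n%:R * s = C ^+ 2 by rewrite /s mulrCA divff ?mulr1// gt_eqF.
have s12 : 12 * s <= 1.
  by rewrite /s mulrA ler_pdivrMr// mul1r; move: xn; rewrite /x; lra.
have sK : 2 * (K * s) <= 1.
  rewrite [K * s]mulrA mulrA ler_pdivrMr// mul1r.
  by move: xn; rewrite /x; lra.
have nt : n%:R * (C / n%:R) ^+ 2 = s.
  by rewrite /s; field; rewrite gt_eqF.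
have h1 : (1 + 3 * (C / n%:R) ^+ 2) ^+ n <= 1 + 6 * s.
  have /exp_le/le_trans : 0 <= 3 * (C / n%:R) ^+ 2 by rewrite mulr_ge0 ?sqr_ge0.
  apply; rewrite mulrCA nt; have -> : 6 * s = 2 * (3 * s) by lra.
  by apply: exp_lin; lra.
have h2 : (1 + (C / n%:R) ^+ 2) ^+ n <= 1 + 2 * s.
  by apply: le_trans (exp_le _ _ (sqr_ge0 _)) _; rewrite nt exp_lin//; lra.
have h2' : 1 <= (1 + (C / n%:R) ^+ 2) ^+ n by rewrite exprn_ege1// lerDl sqr_ge0.
have h3 : (1 + `|C| / n%:R) ^+ n <= expR `|C|.
  have /exp_le/le_trans : 0 <= `|C| / n%:R by rewrite divr_ge0// ltW.
  by apply; rewrite mulrCA divff ?mulr1// gt_eqF.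
have h3' : 0 <= (1 + `|C| / n%:R) ^+ n.
  by rewrite exprn_ge0// addr_ge0// divr_ge0// ltW.
have h1' : 0 <= (1 + 3 * (C / n%:R) ^+ 2) ^+ n.
  by rewrite exprn_ge0// addr_ge0// mulr_ge0 ?sqr_ge0.
have h4 : (1 + `|C| / n%:R) ^+ n * (1 + `|C| / n%:R) ^+ n <= K.
  by apply: le_trans KE; rewrite ler_pM.
have h5 : (1 + 3 * (C / n%:R) ^+ 2) ^+ n * (1 + 3 * (C / n%:R) ^+ 2) ^+ n <=
    (1 + 6 * s) * (1 + 6 * s) by rewrite ler_pM.
have h6 : (1 + `|C| / n%:R) ^+ n * (1 + `|C| / n%:R) ^+ n *
    ((1 + (C / n%:R) ^+ 2) ^+ n - 1) <= K * (2 * s).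
  by rewrite ler_pM ?mulr_ge0 ?subr_ge0// lerBlDl.
apply: le_trans (lerD h5 h6) _.
have ss : s * (12 * s) <= s by rewrite ler_piMr.
lra.
Qed.

(** * Normal operators and Euler factors *)

Section Operators.
Variables (R : realType) (H : hilbertType R).
Implicit Types (x y : H) (S T A B N M : boundedOp H) (z w : R[i]).

Lemma sqr_rnormE x : rnorm x ^+ 2 = complex.Re (inner x x).
Proof. by rewrite -sqr_normE rnormE -rmorphXn. Qed.

Lemma sqr_rnormD x y :
  rnorm (x + y) ^+ 2 = rnorm x ^+ 2 + rnorm y ^+ 2 + 2 * complex.Re (inner x y).
Proof.
rewrite !sqr_rnormE.
have -> : inner (x + y) (x + y) = inner x x + inner x y + (inner y x + inner y y).
  by rewrite linearDl !linearDr.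
rewrite (innerC y x).
case: (inner x x) (inner x y) (inner y y) => [a b] [c d] [e f] /=; ring.
Qed.

Lemma rnorm_bounded T : exists2 b : R, 0 <= b & forall x, rnorm (T x) <= b * rnorm x.
Proof.
have [b Tb] := @op_bounded _ _ T; exists `|b| => // x.
have : rnorm (T x) <= b * rnorm x by rewrite -lecR rmorphM /= -!rnormE.
by move/le_trans; apply; rewrite ler_wpM2r ?rnorm_ge0 ?ler_norm.
Qed.

Lemma adjPl T x y : inner (adj T x) y = inner x (T y).
Proof. by rewrite innerC -adjP -innerC. Qed.

Lemma normal_opE N : normal_op N -> forall x, adj N (N x) = N (adj N x).
Proof. by move=> Nn x; have := congr1 (@^~ x) Nn. Qed.

Lemma rnorm_adj_normal N x : normal_op N -> rnorm (adj N x) = rnorm (N x).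
Proof.
move=> /normal_opE Nn; apply/eqP.
rewrite -(@eqrXn2 _ 2) ?rnorm_ge0// !sqr_rnormE adjPl -Nn.
by rewrite [inner (N x) _]adjP.
Qed.

Lemma linear_addZ T z x y : T (x + z *: y) = T x + z *: T y.
Proof. by rewrite linearD linearZ. Qed.

(** One factor [1 + z T] of an Euler product; the [n]-th iterate stands in for the exponential of
    [n z T]. *)
Definition step T z x : H := x + z *: T x.

Lemma rnorm_step T z b x : (forall y, rnorm (T y) <= b * rnorm y) ->
  rnorm (step T z x) <= (1 + rnorm (z : R[i]^o) * b) * rnorm x.
Proof.
move=> Tb; apply: le_trans (ler_rnormD _ _) _.
by rewrite rnormZ mulrDl mul1r lerD2l -mulrA ler_wpM2l ?rnorm_ge0.
Qed.

Lemma step_comm S T z w x : (forall y, S (T y) = T (S y)) ->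
  step S z (step T w x) = step T w (step S z x).
Proof.
move=> ST; rewrite /step !linear_addZ ST !scalerDr !scalerA [w * z]mulrC.
by rewrite -!addrA; congr (_ + _); rewrite addrCA.
Qed.

Lemma iter_stepB T z n x y :
  iter n (step T z) (x - y) = iter n (step T z) x - iter n (step T z) y.
Proof.
elim: n => //= n ->; rewrite /step linearB /= scalerBr opprD.
by rewrite addrACA.
Qed.

(** Merges two Euler products into one, to be estimated factor by factor. *)
Lemma iter_comp_comm (f g : H -> H) n x : (forall y, f (g y) = g (f y)) ->
  iter n f (iter n g x) = iter n (f \o g) x.
Proof.
move=> fg; have gfn k y : g (iter k f y) = iter k f (g y).
  by elim: k => //= k IH; rewrite -fg IH.
by elim: n => //= n <-; rewrite gfn.
Qed.

(* [z (adj N) - conj z N] is skew-adjoint, so adding it to the identity changes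
   norms only to second order in [z]. *)
Lemma rnorm_step_skew N z b x : normal_op N -> 0 <= b ->
  (forall y, rnorm (N y) <= b * rnorm y) ->
  rnorm (step (adj N) z (step N (- z^*) x)) <=
    (1 + 3 * (rnorm (z : R[i]^o) * b) ^+ 2) * rnorm x.
Proof.
move=> Nn b0 Nb; set t := rnorm (z : R[i]^o).
have t0 : 0 <= t by exact: rnorm_ge0.
have tJ : rnorm (z^* : R[i]^o) = t by rewrite /rnorm norm_conjC.
have N'b y : rnorm (adj N y) <= b * rnorm y by rewrite rnorm_adj_normal.
pose s := z *: adj N x - z^* *: N x.
have -> : step (adj N) z (step N (- z^*) x) = (x + s) - (z * z^*) *: adj N (N x).
  rewrite /step /s linear_addZ scalerDr scalerA mulrN !scaleNr.
  by rewrite -!addrA; congr (_ + _); rewrite addrCA.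
have x0 := rnorm_ge0 x.
have s_le : rnorm s <= 2 * (t * b) * rnorm x.
  apply: le_trans (ler_rnormD _ _) _; rewrite rnormN !rnormZ tJ -/t.
  have := ler_wpM2l t0 (Nb x); have := ler_wpM2l t0 (N'b x); lra.
(* The two terms of the inner product are complex conjugates, so their difference is imaginary. *)
have skew : complex.Re (inner x s) = 0.
  rewrite /s linearBr !linearZr_LR /= -adjP (innerC x (N x)).
  case: (inner _ _) z {tJ s_le s t0 t} => [a c] [e f] /=; ring.
(* Without cross term, [|x + s|^2 = |x|^2 + |s|^2 <= (1 + 4 (t b)^2) |x|^2]. *)
have xs : rnorm (x + s) <= (1 + 2 * (t * b) ^+ 2) * rnorm x.
  have c0 : 0 <= (1 + 2 * (t * b) ^+ 2) * rnorm x.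
    by rewrite mulr_ge0// addr_ge0// mulr_ge0// sqr_ge0.
  rewrite -(@ler_pXn2r _ 2) ?nnegrE ?rnorm_ge0// sqr_rnormD skew mulr0 addr0.
  have := rnorm_ge0 s => s0.
  have : rnorm s ^+ 2 <= (2 * (t * b) * rnorm x) ^+ 2.
    by rewrite lerXn2r ?nnegrE// !mulr_ge0.
  have := sqr_ge0 ((t * b) ^+ 2 * rnorm x).
  by rewrite !exprMn; set u := t ^+ 2 * b ^+ 2; nra.
have NN : rnorm ((z * z^*) *: adj N (N x)) <= (t * b) ^+ 2 * rnorm x.
  have -> : (t * b) ^+ 2 * rnorm x = t * (t * (b * (b * rnorm x))) by ring.
  by rewrite -scalerA !rnormZ tJ -/t !ler_wpM2l// (le_trans (N'b _))// ler_wpM2l.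
apply: le_trans (ler_rnormD _ _) _; rewrite rnormN; lra.
Qed.

(** Telescoping: as [|E^k x| <= (1 + e)^k |x|], the increments are dominated by [e] times a
    geometric sum. *)
Lemma rnorm_iter_sub (E : H -> H) (e : R) n x : 0 <= e ->
  (forall y, rnorm (E y - y) <= e * rnorm y) ->
  rnorm (iter n E x - x) <= ((1 + e) ^+ n - 1) * rnorm x.
Proof.
move=> e0 Ee.
have E1 y : rnorm (E y) <= (1 + e) * rnorm y.
  rewrite -[E y](subrK y) addrC mulrDl mul1r.
  by apply: le_trans (ler_rnormD _ _) _; rewrite lerD2l.
elim: n => [|n IH] /=; first by rewrite !subrr mul0r /rnorm normr0.
rewrite -[E _](subrK (iter n E x)) -addrA.
apply: le_trans (ler_rnormD _ _) _; rewrite exprS.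
have := ler_rnorm_iter n x (addr_ge0 ler01 e0) E1.
have := Ee (iter n E x); have := rnorm_ge0 (iter n E x) => i0 h1 h2.
have := ler_wpM2l e0 h2; lra.
Qed.

(** * Norm bound for the conjugated intertwiner *)

Section Intertwining.
Variables (A N M : boundedOp H) (alpha b : R).
Hypotheses (Nn : normal_op N) (Mn : normal_op M).
Hypothesis (AM : forall x, A (M x) = N (A x)).
Hypotheses (a0 : 0 <= alpha) (b0 : 0 <= b).
Hypothesis (Ab : forall x, rnorm (A x) <= alpha * rnorm x).
Hypothesis (Nb : forall x, rnorm (N x) <= b * rnorm x).
Hypothesis (Mb : forall x, rnorm (M x) <= b * rnorm x).

(* Inserting [(1 - conj w N)^n A (1 + conj w M)^n = A (1 - (conj w M)^2)^n],
   which is close to [A], turns both outer factors into near-isometries. *)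
Lemma rnorm_conjugated_le w n x (d : R) : d = rnorm (w : R[i]^o) * b ->
  rnorm (iter n (step (adj N) w) (A (iter n (step (adj M) (- w)) x))) <=
  ((1 + 3 * d ^+ 2) ^+ n * (1 + 3 * d ^+ 2) ^+ n
   + (1 + d) ^+ n * (1 + d) ^+ n * ((1 + d ^+ 2) ^+ n - 1)) * (alpha * rnorm x).
Proof.
move=> dE; have w0 := rnorm_ge0 (w : R[i]^o).
have d0 : 0 <= d by rewrite dE mulr_ge0.
have wJ : rnorm (w^* : R[i]^o) = rnorm (w : R[i]^o) by rewrite /rnorm norm_conjC.
have wN : rnorm (- w : R[i]^o) = rnorm (w : R[i]^o) by rewrite rnormN.
pose y := iter n (step (adj M) (- w)) x.
pose E := step M (- w^*) \o step M w^*.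
have iterA k u : iter k (step N (- w^*)) (A u) = A (iter k (step M (- w^*)) u).
  by elim: k => //= k ->; rewrite /step linear_addZ AM.
have EE u : rnorm (E u - u) <= d ^+ 2 * rnorm u.
  have -> : E u - u = - (w^* * w^*) *: M (M u).
    rewrite /E /= /step linear_addZ scalerDr scalerA mulNr scaleNr.
    by rewrite addrA addrK addrAC subrr add0r.
  rewrite scaleNr rnormN -scalerA !rnormZ wJ dE; set t := rnorm _ in w0 *.
  have -> : (t * b) ^+ 2 * rnorm u = t * (t * (b * (b * rnorm u))) by ring.
  by rewrite !ler_wpM2l// (le_trans (Mb _))// ler_wpM2l.
(* [A y = A (E^n y) - A (E^n y - y)]: the main term yields the first summand of the bound, the error
   term the second. *)
have split : iter n (step (adj N) w) (A y) =
    iter n (step (adj N) w) (iter n (step N (- w^*)) (A (iter n (step M w^*) y)))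
    - iter n (step (adj N) w) (A (iter n E y - y)).
  rewrite iterA iter_comp_comm; last by move=> u; exact: step_comm.
  by rewrite -iter_stepB -linearB /= opprB addrCA subrr addr0.
rewrite -/y split; apply: le_trans (ler_rnormD _ _) _; rewrite rnormN mulrDl.
have c0 : 0 <= 1 + 3 * d ^+ 2 by rewrite addr_ge0// mulr_ge0 ?sqr_ge0.
apply: lerD.
  rewrite iter_comp_comm; last by move=> u; apply: step_comm => ?; exact: normal_opE.
  apply: le_trans (ler_rnorm_iter _ _ c0 _) _.
    by move=> u; rewrite dE; exact: rnorm_step_skew.
  rewrite -mulrA ler_wpM2l ?exprn_ge0//; apply: le_trans (Ab _) _.
  rewrite mulrCA ler_wpM2l// iter_comp_comm; last first.
    by move=> u; apply: step_comm => ?; exact/esym/normal_opE.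
  apply: ler_rnorm_iter => // u /=.
  rewrite step_comm; last by move=> ?; exact/esym/normal_opE.
  have -> : w^* = - (- w)^* by rewrite rmorphN opprK.
  by rewrite dE -wN rnorm_step_skew.
(* In the error term crude bounds on the outer factors suffice, smallness coming from
   [E^n y - y]. *)
have d1 : 0 <= 1 + d by rewrite addr_ge0.
apply: le_trans (ler_rnorm_iter _ _ d1 _) _.
  by move=> u; rewrite dE; apply: rnorm_step => v; rewrite rnorm_adj_normal.
rewrite -!mulrA ler_wpM2l ?exprn_ge0//; apply: le_trans (Ab _) _.
rewrite !(mulrCA _ alpha) ler_wpM2l// mulrCA.
apply: le_trans (rnorm_iter_sub _ _ (sqr_ge0 d) EE) _.
rewrite ler_wpM2l ?subr_ge0 ?exprn_ege1 ?lerDl ?sqr_ge0//.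
apply: ler_rnorm_iter => // u; rewrite dE -wN.
by apply: rnorm_step => v; rewrite rnorm_adj_normal.
Qed.

End Intertwining.

(** * First coefficients of vector-valued polynomials *)

(** A polynomial starting with [u + z v]; having [d.+2] terms, it always includes the coefficient of
    [z]. *)
Definition poly_jet (f : R[i] -> H) u v := exists d (c : nat -> H),
  [/\ c 0%N = u, c 1%N = v & forall z, f z = \sum_(j < d.+2) z ^+ j *: c j].

Lemma poly_jet_step f u v T z0 : poly_jet f u v ->
  poly_jet (fun z => step T (z0 * z) (f z)) u (v + z0 *: T u).
Proof.
move=> [d [c [c0 c1 fc]]].
(* The factor [1 + z0 z T] adds shifted coefficients; [c] is cut off at [d.+2], its later values
   being arbitrary. *)
exists d.+1, (fun j => (if (j < d.+2)%N then c j else 0)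
                       + (if j is i.+1 then z0 *: T (c i) else 0)).
split=> [||z]; rewrite ?c0 ?c1 ?addr0//=.
under [RHS]eq_bigr do rewrite scalerDr.
rewrite big_split /= /step fc; congr (_ + _).
  rewrite [RHS]big_ord_recr /= ltnn scaler0 addr0.
  by apply: eq_bigr => j _; rewrite ltn_ord.
rewrite [RHS]big_ord_recl scaler0 add0r linear_sum scaler_sumr.
apply: eq_bigr => j _; rewrite lift0 linearZ /= !scalerA exprS.
by congr (_ *: _); ring.
Qed.

Lemma poly_jet_iter_step f u v T z0 n : poly_jet f u v ->
  poly_jet (fun z => iter n (step T (z0 * z)) (f z)) u (v + (n%:R * z0) *: T u).
Proof.
move=> fj; elim: n => [|n IH]; first by rewrite mul0r scale0r addr0.
by rewrite -natr1 mulrDl mul1r scalerDl addrA; exact: poly_jet_step.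
Qed.

Lemma poly_jet_linear f u v A : poly_jet f u v ->
  poly_jet (fun z => A (f z)) (A u) (A v).
Proof.
move=> [d [c [<- <- fc]]]; exists d, (A \o c); split=> // z.
by rewrite fc linear_sum; apply: eq_bigr => j _; rewrite linearZ.
Qed.

Lemma poly_jet_cst u : poly_jet (fun=> u) u 0.
Proof.
exists 0%N, (fun j => if j is 0 then u else 0); split=> // z.
by rewrite !big_ord_recl big_ord0 /= scaler0 !addr0 expr0 scale1r.
Qed.

(** * The Fuglede-Putnam theorem *)

Lemma fuglede_putnam A N M : normal_op N -> normal_op M ->
  (forall x, A (M x) = N (A x)) -> forall x, A (adj M x) = adj N (A x).
Proof.
move=> Nn Mn AM x.
have [al al0 Aal] := rnorm_bounded A.
have [b1 b10 Nb1] := rnorm_bounded N; have [b2 b20 Mb2] := rnorm_bounded M.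
pose b := b1 + b2; have b0 : 0 <= b by rewrite addr_ge0.
have Nb y : rnorm (N y) <= b * rnorm y.
  by rewrite (le_trans (Nb1 _))// ler_wpM2r ?rnorm_ge0// lerDl.
have Mb y : rnorm (M y) <= b * rnorm y.
  by rewrite (le_trans (Mb2 _))// ler_wpM2r ?rnorm_ge0// lerDr.
pose D := adj N (A x) - A (adj M x).
(* [n] depends on [r] but the bound does not, which forces [D = 0]. *)
have bound (r : R) : 0 < r -> r * rnorm D <= 4 * (al * rnorm x).
  move=> r0; have [n n0 nle] := exp_factors_le4 (r * b).
  pose m : R[i] := n%:R^-1.
  have nm : n%:R * m = 1 by rewrite divff// pnatr_eq0 -lt0n.
  (* Since [n m = 1], the coefficient of [z] is exactly [D]. *)
  have := poly_jet_iter_step (adj N) m n (poly_jet_linear A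
            (poly_jet_iter_step (adj M) (- m) n (poly_jet_cst x))).
  rewrite mulrN nm add0r scaleN1r scale1r linearN addrC => -[d [c [_ c1 fc]]].
  have -> : D = c 1%N by rewrite c1.
  apply: (@cauchy_estimate1 _ _ d.+2) => // z zr; rewrite -fc mulNr.
  have mz : rnorm (m * z : R[i]^o) * b = r * b / n%:R.
    rewrite (_ : rnorm (m * z : R[i]^o) = n%:R^-1 * r).
      by rewrite [RHS]mulrC mulrA.
    rewrite -zr (rnormZ m (z : R[i]^o)); congr (_ * _).
    apply: complexI; rewrite -rnormE ger0_norm ?invr_ge0 ?ler0n//.
    by rewrite fmorphV rmorph_nat.
  apply: le_trans (rnorm_conjugated_le Nn Mn AM al0 b0 Aal Nb Mb _ _ (esym mz)) _.
  rewrite ler_wpM2r ?mulr_ge0 ?rnorm_ge0//.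
  by rewrite [`|r * b|]ger0_norm ?mulr_ge0 ?(ltW r0)// in nle.
apply/esym/eqP; rewrite -subr_eq0; apply/eqP/rnorm_eq0; rewrite -/D.
have := rnorm_ge0 D; rewrite le_eqVlt => /predU1P[//|D0].
have c0 : 0 <= 4 * (al * rnorm x) by rewrite !mulr_ge0 ?rnorm_ge0.
(* With [c = 4 (al |x|)], this radius would give [c + 1 <= c]. *)
have := bound ((4 * (al * rnorm x) + 1) / rnorm D).
by rewrite divfK ?gt_eqF// divr_gt0 ?ltr_wpDl// => /(_ isT); lra.
Qed.

(** * Scalar multiples and adjoints *)

Section Scale.
Variables (z : R[i]) (T : boundedOp H).

Let scale_bounded : exists b : R, forall x, `|(z \*: T) x| <= b%:C * `|x|.
Proof.
have [b _ Tb] := rnorm_bounded T; exists (rnorm (z : R[i]^o) * b) => x.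
rewrite !rnormE -rmorphM lecR rnormZ -mulrA.
by rewrite ler_wpM2l ?rnorm_ge0.
Qed.

HB.instance Definition _ := isBoundedOp.Build R H (z \*: T) scale_bounded.

Lemma adj_scale : adj (z \*: T) = z^* \*: adj T.
Proof.
apply/esym/adj_unique => x y; rewrite linearZl_LR linearZr_LR /= conjCK.
by rewrite adjP.
Qed.

Lemma normal_scale : normal_op T -> normal_op (z \*: T).
Proof.
move=> Tn; apply/funext => x; rewrite /= adj_scale /= !linearZ /= normal_opE//.
by rewrite !scalerA mulrC.
Qed.

End Scale.

Lemma adj_comp A B : adj (A \o B) = adj B \o adj A.
Proof. by apply/esym/adj_unique => x y; rewrite /= -!adjP. Qed.

End Operators.

(** * Cancellation of phases in the product *)

Theorem theorem2p2 (R : realType) (H : hilbertType R) (A B : boundedOp H)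
    (lambda : R[i])
    (Aqn : quasinormal_op A) (Bn : normal_op B)
    (ABl : A \o B = lambda \*: (B \o A)) (AB0 : A \o B <> \0)
    (lambda1 : `|lambda| = 1) :
  quasinormal_op (A \o B).
Proof.
have ll : lambda^* * lambda = 1 by rewrite mulrC -normCK lambda1 expr1n.
have AB x : A (B x) = lambda *: B (A x) by exact: (congr1 (@^~ x) ABl).
have AP x : A (adj A (A x)) = adj A (A (A x)) by exact: (congr1 (@^~ x) Aqn).
(* Fuglede-Putnam for the normal operators [lambda \*: B] and [B]. *)
have ABs x : A (adj B x) = lambda^* *: adj B (A x).
  by rewrite (fuglede_putnam (normal_scale lambda Bn) Bn AB) adj_scale.
have BA x : B (A x) = lambda^* *: A (B x) by rewrite AB scalerA ll scale1r.
have BsA x : adj B (A x) = lambda *: A (adj B x).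
  by rewrite ABs scalerA mulrC ll scale1r.
(* The adjoint of [ABs]; [AsBs] is that of [AB]. *)
have AsB x : adj A (B x) = lambda^* *: B (adj A x).
  apply: inner_inj => y; rewrite linearZr_LR /= conjCK -adjP.
  by rewrite -[in RHS]adjPl -adjP ABs linearZl_LR /= mulrA [lambda * _]mulrC ll mul1r adjPl.
have AsBs x : adj A (adj B x) = lambda *: adj B (adj A x).
  by apply: inner_inj => y; rewrite linearZr_LR /= -!adjP AB linearZl_LR /= mulrA ll mul1r.
(* [A] and [adj A] contribute conjugate phases, of product 1. *)
have PB x : adj A (A (B x)) = B (adj A (A x)).
  by rewrite AB linearZ /= AsB scalerA mulrC ll scale1r.
have PBs x : adj A (A (adj B x)) = adj B (adj A (A x)).
  by rewrite ABs linearZ /= AsBs scalerA ll scale1r.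
have SA x : adj B (B (A x)) = A (adj B (B x)).
  by rewrite BA linearZ /= BsA scalerA ll scale1r.
apply/funext => x; rewrite /= adj_comp /=.
(* With [P = adj A A], moving [P] to the front, and [A] past [adj B B] on the right, leaves
   [P A B (adj B) B x] against [P A (adj B) B B x]. *)
by rewrite -PBs -PB AP -PBs SA (normal_opE Bn (B x)).
Qed.
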